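(* Let $\mathcal{Z}=(z_0,z_1,z_2,\dots)$ be an increasing sequence of positive integers (that is, $z_0\le z_1\le z_2\le\cdots$), let $n\ge 1$, and let $x$ be an integer larger than $z_{n-1}$. Let $t_n(\,\cdot\,;w,\cdot)$ be the $n$-th generalized Gončarov polynomial and let $PF_\pi(\mathcal{Z})$ be the number of block-labelings of $\pi$ by elements of $\{1,\dots,x\}$ that are $\vec z$-parking functions (both defined in the context). Then $$t_n(0;w,-\mathcal{Z}) = t_n(x;w,x-\mathcal{Z}) = \sum_{\pi\in\Pi_n} w(\hat 0,\pi)\cdot PF_\pi(\mathcal{Z}),$$ where $x-\mathcal{Z}=(x-z_0,x-z_1,x-z_2,\dots)$ and $-\mathcal{Z}=(-z_0,-z_1,-z_2,\dots)$.
   Context: Let $\mathbb{K}$ be a field of characteristic zero (e.g. $\mathbb{Q}$, $\mathbb{R}$ or $\mathbb{C}$), let $w_2,w_3,\dots$ be independent variables, set $w_1=1$, and let $A=\mathbb{K}[w_2,w_3,\dots]$. Let $[n]=\{1,\dots,n\}$ and let $\Pi_n$ be the set of all set partitions of $[n]$, ordered by refinement, with minimal element $\hat 0$ (all blocks singletons). For $\pi\in\Pi_n$, $|\pi|$ is the number of blocks of $\pi$, $\mathrm{Block}(\pi)$ is the set of blocks of $\pi$, and $w(\hat 0,\pi)=w_1^{\lambda_1}w_2^{\lambda_2}\cdots w_n^{\lambda_n}$, where $\lambda_i$ is the number of blocks of $\pi$ of size $i$. Define $a_0(x;w)=1$ and $a_n(x;w)=\sum_{\pi\in\Pi_n} w(\hat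 0,\pi)\,x^{|\pi|}\in A[x]$ for $n\ge 1$. For any sequence $\mathcal{Y}=(y_0,y_1,\dots)$ of elements of $\mathbb{K}$, the generalized Gončarov polynomials $t_n(x;w,\mathcal{Y})\in A[x]$, $n\ge 0$, are the unique polynomials satisfying, for all $n\ge 0$, $$a_n(x;w)=\sum_{i=0}^{n}\binom{n}{i}\,a_{n-i}(y_i;w)\,t_i(x;w,\mathcal{Y}).$$ Parking functions: put $X=\{1,\dots,x\}$ and $\vec z=(z_0,z_1,\dots,z_{n-1})$. A sequence $(x_1,\dots,x_n)$ of positive integers is a $\vec z$-parking function if its nondecreasing rearrangement $x_{(1)}\le\cdots\le x_{(n)}$ satisfies $x_{(i)}\le z_{i-1}$ for all $i=1,\dots,n$. For $\pi\in\Pi_n$ and $f:\mathrm{Block}(\pi)\to X$, let $f_\pi=(x_1,\dots,x_n)$ where $x_i=f(B)$ for the block $B$ of $\pi$ containing $i$. Then $PF_\pi(\mathcal{Z})$ is the number of functions $f:\mathrm{Block}(\pi)\to X$ such that $f_\pi$ is a $\vec z$-parking function. *)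

(* Defs.v *)
From mathcomp Require Import all_boot all_order all_algebra.
From mathcomp.multinomials Require Import monalg.

Set Implicit Arguments.
Unset Strict Implicit.
Unset Printing Implicit Defensive.

Import GRing.Theory.
Local Open Scope ring_scope.

Section Goncarov.
Variable K : fieldType.

(* A = K[w_2, w_3, ...]: commutative polynomials over K in variables indexed
   by nat, the variable of index k standing for w_(k+2). *)
Local Notation coefA := {malg K[{cmonom nat}]}.

(* w_1 = 1; the value at 0 is junk and is never used. *)
Definition wvar (i : nat) : coefA :=
  if (i <= 1)%N then 1 else << ucm (i - 2)%N >>.

(* Set partitions of [n] are the P with partition P [set: 'I_n], the point i
   of 'I_n standing for i + 1. *)
Definition weight n (P : {set {set 'I_n}}) : coefA :=
  \prod_(1 <= i < n.+1) wvar i ^+ #|[set B in P | #|B| == i]|.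

(* No separate clause for n = 0: see gon_basis0. *)
Definition gon_basis (n : nat) : {poly coefA} :=
  \sum_(P : {set {set 'I_n}} | partition P [set: 'I_n]) weight P *: 'X^#|P|.

Definition goncarov_spec (Y : nat -> K) (t : nat -> {poly coefA}) : Prop :=
  forall n : nat,
    gon_basis n =
      \sum_(i < n.+1)
        ('C(n, i)%:R * (gon_basis (n - i)).[(Y i)%:A]) *: t i.

Lemma gon_basis0 : gon_basis 0 = 1.
Proof.
rewrite /gon_basis (big_pred1 set0) => [|P] /=.
  by rewrite cards0 expr0 /weight big_nil scale1r.
rewrite (_ : [set: 'I_0] = set0); last by apply/setP=> -[].
by rewrite partition_set0.
Qed.

Lemma goncarov_spec_rec Y t n : goncarov_spec Y t ->
  t n = gon_basis n -
    \sum_(i < n) ('C(n, i)%:R * (gon_basis (n - i)).[(Y i)%:A]) *: t i.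
Proof.
move=> ht; rewrite {1}(ht n) big_ord_recr /= subnn gon_basis0 hornerC binn.
by rewrite mulr1 scale1r addrAC subrr add0r.
Qed.

Lemma goncarov_uniq Y t1 t2 :
  goncarov_spec Y t1 -> goncarov_spec Y t2 -> t1 =1 t2.
Proof.
move=> h1 h2 n; elim/ltn_ind: n => n IHn.
rewrite (goncarov_spec_rec n h1) (goncarov_spec_rec n h2).
by congr (_ - _); apply: eq_bigr => i _; rewrite IHn.
Qed.

Lemma goncarov_exists Y : {t | goncarov_spec Y t}.
Proof.
pose step s : {poly coefA} := let n := size s in gon_basis n -
  \sum_(i < n) ('C(n, i)%:R * (gon_basis (n - i)).[(Y i)%:A]) *: s`_i.
pose ts := fix ts n := if n is m.+1 then rcons (ts m) (step (ts m)) else [::].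
have szts n : size (ts n) = n by elim: n => //= n; rewrite size_rcons => ->.
have nthts n i : (i < n)%N -> (ts n)`_i = step (ts i).
  elim: n => //= n IHn; rewrite ltnS leq_eqVlt nth_rcons szts.
  by case/orP=> [/eqP->|lt_in]; rewrite ?ltnn ?eqxx // lt_in IHn.
exists (fun n => step (ts n)) => n.
rewrite big_ord_recr /= subnn gon_basis0 hornerC binn mulr1 scale1r.
rewrite {2}/step szts; under [X in _ - X]eq_bigr => i _ do rewrite nthts //.
by rewrite addrC subrK.
Qed.

(* The sequence satisfying goncarov_spec, unique by goncarov_uniq. *)
Definition goncarov (Y : nat -> K) (n : nat) : {poly coefA} :=
  sval (goncarov_exists Y) n.

Lemma goncarovP Y : goncarov_spec Y (goncarov Y).
Proof. exact: svalP (goncarov_exists Y). Qed.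

End Goncarov.

(* Positions are numbered from 0, so the condition below is
   x_(i+1) <= z_i. *)
Definition parking (z : nat -> nat) (s : seq nat) : bool :=
  all (leq 1) s &&
  [forall i : 'I_(size s), (nth 0 (sort leq s) i <= z i)%N].

(* Functions Block(P) -> {1, ..., x} are encoded as the finite functions on all
   subsets of 'I_n that take values in {1, ..., x} on P and 0 outside P. *)
Definition block_labelings n x (P : {set {set 'I_n}}) :
    {set {ffun {set 'I_n} -> 'I_x.+1}} :=
  [set f in pffun_on ord0 (mem P) [pred k : 'I_x.+1 | 0 < k]%N].

Lemma card_block_labelings n x (P : {set {set 'I_n}}) :
  #|block_labelings x P| = (x ^ #|P|)%N.
Proof.
rewrite /block_labelings cardsE card_pffun_on; congr (_ ^ _)%N.
have := cardD1 (ord0 : 'I_x.+1) 'I_x.+1; rewrite card_ord => -[def_x].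
rewrite [RHS]def_x; apply: eq_card => i; rewrite !inE andbT; exact: lt0n.
Qed.

(* f_P = (x_1, ..., x_n); pblock P i is the block of P containing i. *)
Definition label_seq n x (P : {set {set 'I_n}})
    (f : {ffun {set 'I_n} -> 'I_x.+1}) : seq nat :=
  [seq (f (pblock P i) : nat) | i <- enum 'I_n].

Definition PF n (z : nat -> nat) (x : nat) (P : {set {set 'I_n}}) : nat :=
  #|[set f in block_labelings x P | parking z (label_seq P f)]|.

Arguments weight K {n} P.

(* Main.v *)
Require Import Defs.
From mathcomp Require Import all_boot all_order all_algebra.
From mathcomp.multinomials Require Import monalg.

Set Implicit Arguments.
Unset Strict Implicit.
Unset Printing Implicit Defensive.

Import Order.TTheory GRing.Theory.
Local Open Scope ring_scope.

(** The numbers t_n(v) are pinned down by their defining recurrence, so both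
    equalities follow once the quantities on the other side are seen to satisfy
    the same recurrence. Everything is done with sums indexed by subsets S of a
    finite set D rather than with binomial coefficients: since t_i and a_i
    depend on cardinals only, the recurrence reads
      a_#|D|(v) = sum over S included in D of a_#|D \ S|(y_#|S|) t_#|S|(v),
    and by induction on #|D| it has only one solution F(S) in place of
    t_#|S|(v), even among functions of the set S itself
    ([goncarov_set_uniq]).

    The bridge between partitions and subsets is [sum_partition_split]: choosing
    a partition P of D and some of its blocks Q amounts to choosing the union S
    of these blocks, a partition Q of S and a partition of D \ S. As block
    weights are multiplicative, an expansion of v^#|P| over the subsets Q of P
    turns into a convolution of sums over partitions.

    The binomial theorem for (u + v)^#|P| gives the binomial identity
    [block_polyD] for the a_n. It implies that t_n(c + v) for the nodes c + y is
    t_n(v) for the nodes y ([goncarov_shift]), which is the first equality with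
    v = 0 and c = x.

    For the second one, each labeling f of the blocks of P by 1, ..., x has
    exactly one core: a set Q of blocks, with m points in all, such that f is
    parking on Q and exceeds z_m on the other blocks ([parking_core]). Sorting
    the labelings by their cores gives
      x^#|P| = sum over Q included in P of PF(Q) (x - z_m)^#|P \ Q|
    ([labelings_split]), and summing over the partitions P of D shows that the
    weighted parking sums F(D) solve the recurrence at v = x for the nodes
    x - z_i ([goncarov_parking]). *)

(** * Sums over subsets and over set partitions *)

Lemma sum_subset_card (R : pzSemiRingType) (T : finType) (D : {set T})
    (F : nat -> R) :
  \sum_(S : {set T} | S \subset D) F #|S| =
    \sum_(i < #|D|.+1) 'C(#|D|, i)%:R * F i.
Proof.
rewrite (partition_big (fun S : {set T} => inord #|S| : 'I_#|D|.+1) xpredT) //.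
apply: eq_bigr => i _; rewrite -(cards_draws D) -sum1dep_card natr_sum.
rewrite mulr_suml; apply: eq_big => [S | S /andP[sSD /eqP <-]]; last first.
  by rewrite mul1r inordK // ltnS subset_leq_card.
have [sSD | //] /= := boolP (S \subset D).
by rewrite -(inj_eq val_inj) /= inordK // ltnS subset_leq_card.
Qed.

(** Both sides run over the pairs of disjoint subsets of [D]. *)
Lemma exchange_disjoint_subsets (V : nmodType) (T : finType) (D : {set T})
    (F : {set T} -> {set T} -> V) :
  \sum_(S : {set T} | S \subset D)
    \sum_(S' : {set T} | S' \subset D :\: S) F S S' =
  \sum_(S' : {set T} | S' \subset D)
    \sum_(S : {set T} | S \subset D :\: S') F S S'.
Proof.
rewrite (exchange_big_dep (fun S' : {set T} => S' \subset D)) => [|S S' _] /=.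
  apply: eq_bigr => S' sS'D; apply: eq_bigl => S.
  by rewrite !subsetD sS'D disjoint_sym.
by rewrite subsetD => /andP[].
Qed.

Section PartitionSums.
Variable T : finType.
Implicit Types (D S : {set T}) (P Q : {set {set T}}).

Lemma subset_partition {P Q D} :
  partition P D -> Q \subset P -> partition Q (cover Q).
Proof.
case/and3P=> _ tiP P0 sQP; apply/and3P; split=> //; first exact: trivIsetS tiP.
exact: contra (subsetP sQP _) P0.
Qed.

Lemma cover_subset {P Q D} :
  partition P D -> Q \subset P -> cover Q \subset D.
Proof.
move=> partP sQP; apply/bigcupsP => B QB.
exact: partitionS partP (subsetP sQP _ QB).
Qed.

Lemma partitionD {P Q D} :
  partition P D -> Q \subset P -> partition (P :\: Q) (D :\: cover Q).
Proof.
move=> partP sQP; case/and3P: (partP) => /eqP covP tiP P0.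
rewrite /partition trivIsetD // inE negb_and P0 orbT !andbT.
apply/eqP/setP=> i; rewrite inE -covP; apply/bigcupP/andP => [[B]|[]].
  case/setDP=> PB nQB Bi; split; last by apply/bigcupP; exists B.
  apply: contra nQB => /bigcupP[C QC Ci].
  by rewrite -(def_pblock tiP PB Bi) (def_pblock tiP (subsetP sQP _ QC) Ci).
move=> nQi /bigcupP[B PB Bi]; exists B => //; rewrite inE PB andbT.
by apply: contra nQi => QB; apply/bigcupP; exists B.
Qed.

Lemma partitionU {P Q D S} : S \subset D -> partition Q S ->
  partition P (D :\: S) -> partition (Q :|: P) D /\ [disjoint Q & P].
Proof.
move=> sSD /and3P[/eqP covQ tiQ Q0] /and3P[/eqP covP tiP P0].
have dis: [disjoint cover Q & cover P].
  by rewrite covQ covP disjoint_sym disjoints_subset setDE subsetIr.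
split.
  rewrite /partition inE negb_or P0 Q0 trivIsetU // !andbT /cover bigcup_setU.
  by rewrite -!/(cover _) covP covQ -{1}(setIidPr sSD) setID.
rewrite -setI_eq0; apply: contraNT P0 => /set0Pn[B /setIP[QB PB]].
suff <-: B = set0 by [].
apply/setP=> i; rewrite inE; apply/negP => Bi.
have: i \in cover P by apply/bigcupP; exists B.
by rewrite (disjointFr dis) //; apply/bigcupP; exists B.
Qed.

(** The bijection sends (P, Q) to the triple made of cover Q, Q and the
    remaining blocks of P; conversely the two partitions are put together. This
    is the product rule for exponential generating functions, in set form. *)
Lemma sum_partition_split (V : nmodType) D
    (F : {set {set T}} -> {set {set T}} -> V) :
  \sum_(P | partition P D)
    \sum_(Q : {set {set T}} | Q \subset P) F Q (P :\: Q) =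
  \sum_(S : {set T} | S \subset D) \sum_(Q | partition Q S)
    \sum_(P | partition P (D :\: S)) F Q P.
Proof.
pose inD Q := partition Q (cover Q) && (cover Q \subset D).
rewrite (exchange_big_dep inD) /inD /=; last first.
  move=> P Q partP sQP.
  by rewrite (subset_partition partP) // (cover_subset partP).
rewrite [RHS](exchange_big_dep inD) /inD /=; last first.
  by move=> S Q sSD partQ; rewrite (cover_partition partQ) partQ.
apply: eq_bigr => Q /andP[partQ sQD].
(* For a fixed Q, the set S can only be the union of the blocks of Q. *)
rewrite [RHS](big_pred1 (cover Q)) => [|S]; last first.
  apply/andP/eqP => [[_ /cover_partition <-] //|->]; by split.
rewrite (reindex_onto (fun P => Q :|: P) (fun P => P :\: Q)) /=; last first.
  by move=> P /andP[_ sQP]; rewrite setDE setUIr setUCr setIT; apply/setUidPr.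
apply: eq_big => [P|P /andP[_ /eqP -> //]].
apply/idP/idP=> [/andP[/andP[partP sQP] /eqP <-]|partP].
  exact: partitionD partP sQP.
have [-> dis] := partitionU sQD partQ partP.
rewrite subsetUl /= setDUl setDv set0U; apply/eqP/setDidPl.
by rewrite disjoint_sym.
Qed.

End PartitionSums.

Lemma sum_partition_imset (V : nmodType) (T T' : finType) (f : T' -> T)
    (D : {set T'}) (F : {set {set T}} -> V) : injective f ->
  \sum_(P | partition P (f @: D)) F P =
  \sum_(Q | partition Q D) F [set f @: (B : {set T'}) | B in Q].
Proof.
move=> f_inj; have fK: cancel (fun B : {set T'} => f @: B) (fun B => f @^-1: B).
  by move=> B; apply/setP=> i; rewrite inE mem_imset.
rewrite (reindex_onto
  (fun Q : {set {set T'}} => [set f @: (B : {set T'}) | B in Q])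
  (fun P : {set {set T}} => [set f @^-1: (B : {set T}) | B in P])) /=.
  apply: eq_bigl => Q; rewrite imset_partition // -imset_comp.
  by rewrite (eq_imset _ (g := id)) ?imset_id ?eqxx ?andbT.
move=> P partP; rewrite -imset_comp.
rewrite (eq_in_imset (g := id)) ?imset_id // => B PB /=.
apply/setP=> i; apply/imsetP/idP => [[j]|Bi]; first by rewrite inE => ? ->.
have /imsetP[j _ def_i] := subsetP (partitionS partP PB) i Bi.
by exists j; rewrite // inE -def_i.
Qed.

(** * Generalized Goncarov polynomials over a commutative ring *)

Section GoncarovSequences.
Variables (R : comNzRingType) (w : nat -> R).

Definition block_weight (T : finType) (P : {set {set T}}) : R :=
  \prod_(B in P) w #|B|.

Definition block_poly (n : nat) : {poly R} :=
  \sum_(P : {set {set 'I_n}} | partition P [set: 'I_n])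
    block_weight P *: 'X^#|P|.

(** The recurrence of [goncarov_spec], with nodes in [R] instead of scalars of a
    base field: translating the nodes by any element of [R] then makes sense. *)
Definition goncarov_seq (y : nat -> R) (t : nat -> {poly R}) : Prop :=
  forall n, block_poly n =
    \sum_(i < n.+1) ('C(n, i)%:R * (block_poly (n - i)).[y i]) *: t i.

(** A partition sum depends only on the cardinal of the ground set: partitions
    are carried along an enumeration of [D]. *)
Lemma block_poly_set (T : finType) (D : {set T}) (v : R) :
  (block_poly #|D|).[v] =
    \sum_(P | partition P D) block_weight P * v ^+ #|P|.
Proof.
have imD : [set enum_val i | i in [set: 'I_#|D|]] = D.
  apply/setP=> i; apply/imsetP/idP => [[j _ ->]|Di]; first exact: enum_valP.
  by exists (enum_rank_in Di i); rewrite ?enum_rankK_in.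
rewrite -{2}imD sum_partition_imset; last exact: enum_val_inj.
rewrite /block_poly horner_sum; apply: eq_bigr => P _.
have inj_im : injective (fun B : {set 'I_#|D|} => enum_val @: B).
  exact/imset_inj/enum_val_inj.
rewrite hornerZ hornerXn (card_imset _ inj_im) /block_weight.
rewrite big_imset => [|B C _ _]; last exact: inj_im.
congr (_ * _); apply: eq_bigr => B _.
by rewrite card_imset //; apply: enum_val_inj.
Qed.

Lemma block_poly0 : block_poly 0 = 1.
Proof.
rewrite /block_poly (big_pred1 set0) => [|P] /=.
  by rewrite cards0 expr0 /block_weight big_set0 scale1r.
by rewrite [setT](_ : _ = set0) ?partition_set0 //; apply/setP=> -[].
Qed.

Lemma block_weightD (T : finType) (P Q : {set {set T}}) : Q \subset P ->
  block_weight P = block_weight Q * block_weight (P :\: Q).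
Proof.
by move=> sQP; rewrite /block_weight [LHS](big_setID Q) /= (setIidPr sQP).
Qed.

(** The [block_poly] form a sequence of binomial type: (u + v)^#|P| is expanded
    over the sets Q of blocks that contribute u, and the blocks of Q are then
    gathered into one subset S of D. *)
Lemma block_polyD (T : finType) (D : {set T}) (u v : R) :
  (block_poly #|D|).[u + v] =
    \sum_(S : {set T} | S \subset D)
      (block_poly #|S|).[u] * (block_poly #|D :\: S|).[v].
Proof.
rewrite block_poly_set.
transitivity (\sum_(P | partition P D) \sum_(Q : {set {set T}} | Q \subset P)
   (block_weight Q * u ^+ #|Q|) * (block_weight (P :\: Q) * v ^+ #|P :\: Q|)).
  apply: eq_bigr => P _; rewrite addrC exprDn.
  transitivity (block_weight P * \sum_(Q : {set {set T}} | Q \subset P)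
     v ^+ (#|P| - #|Q|) * u ^+ #|Q|).
    rewrite (sum_subset_card P (fun i => v ^+ (#|P| - i) * u ^+ i)).
    congr (_ * _); apply: eq_bigr => i _.
    by rewrite mulr_natl.
  rewrite mulr_sumr; apply: eq_bigr => Q sQP.
  by rewrite (block_weightD sQP) -(cardsDS sQP) [X in _ * X]mulrC mulrACA.
rewrite (sum_partition_split D (fun Q P =>
  block_weight Q * u ^+ #|Q| * (block_weight P * v ^+ #|P|))).
apply: eq_bigr => S sSD; rewrite !block_poly_set mulr_suml.
by apply: eq_bigr => Q _; rewrite mulr_sumr.
Qed.

(** As #|D| choose i counts the subsets with i elements, the binomial
    coefficients of the recurrence disappear. *)
Lemma goncarov_set y t (T : finType) (D : {set T}) (v : R) :
  goncarov_seq y t ->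
  (block_poly #|D|).[v] =
    \sum_(S : {set T} | S \subset D)
      (block_poly #|D :\: S|).[y #|S|] * (t #|S|).[v].
Proof.
move=> ->; rewrite horner_sum.
transitivity (\sum_(S : {set T} | S \subset D)
   (block_poly (#|D| - #|S|)).[y #|S|] * (t #|S|).[v]).
  rewrite (sum_subset_card D (fun i =>
    (block_poly (#|D| - i)).[y i] * (t i).[v])); apply: eq_bigr => i _.
  by rewrite hornerZ mulrA.
by apply: eq_bigr => S sSD; rewrite cardsDS.
Qed.

(** In the recurrence for D the term S = D has coefficient a_0 = 1, and
    induction on the cardinal applies to all the others. That F depends on its
    argument only through the cardinal is a consequence, so no relabeling of
    points is needed when F is defined combinatorially. *)
Lemma goncarov_set_uniq y t (T : finType) (F : {set T} -> R) (v : R) :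
  goncarov_seq y t ->
  (forall D : {set T}, (block_poly #|D|).[v] =
    \sum_(S : {set T} | S \subset D) (block_poly #|D :\: S|).[y #|S|] * F S) ->
  forall D : {set T}, F D = (t #|D|).[v].
Proof.
move=> tP specF D; have [m] := ubnP #|D|; elim: m => // m IHm in D *.
rewrite ltnS => leDm; have := specF D; rewrite (goncarov_set _ _ tP).
rewrite !(bigD1 D (P := fun S : {set T} => S \subset D)) //= !setDv cards0.
rewrite block_poly0 hornerC !mul1r.
rewrite [X in _ + X = _](_ : _ = \sum_(S : {set T} | (S \subset D) && (S != D))
  (block_poly #|D :\: S|).[y #|S|] * F S).
  by move/addIr.
apply: eq_bigr => S; rewrite andbC -properEneq => /proper_card ltSD.
by rewrite IHm // (leq_trans ltSD).
Qed.

(** Write y = - c + (c + y) in the recurrence for y and expand by binomial type.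
    After exchanging the two subsets, the inner sum is the recurrence for the
    nodes c + y at c + v, and the outer one recombines - c with c + v. *)
Lemma goncarov_shift y t y' t' (c : R) (n : nat) (v : R) :
  goncarov_seq y t -> goncarov_seq y' t' -> (forall i, y' i = c + y i) ->
  (t' n).[c + v] = (t n).[v].
Proof.
move=> tP t'P y'E; pose F (S : {set 'I_n}) := (t' #|S|).[c + v].
suff /(_ setT): forall D, F D = (t #|D|).[v] by rewrite /F cardsT card_ord.
apply: (goncarov_set_uniq tP) => D.
rewrite -[v in LHS](addKr c) block_polyD.
under eq_bigr => S' _ do rewrite [X in _ * X](goncarov_set _ _ t'P) mulr_sumr.
rewrite -exchange_disjoint_subsets; apply: eq_bigr => S _.
rewrite -[y _](addKr c) -y'E block_polyD mulr_suml.
by apply: eq_bigr => S' _; rewrite setDDl setUC -setDDl mulrA.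
Qed.

Lemma goncarov_shift0 y t y' t' (c : R) (n : nat) :
  goncarov_seq y t -> goncarov_seq y' t' -> (forall i, y' i = c + y i) ->
  (t n).[0] = (t' n).[c].
Proof.
by move=> tP t'P y'E; rewrite -(goncarov_shift n 0 tP t'P y'E) addr0.
Qed.

End GoncarovSequences.

(** * Labelings of blocks and their parking cores *)

Section Parking.
Variables (z : nat -> nat).
Hypothesis z_mono : forall i j : nat, (i <= j)%N -> (z i <= z j)%N.
Variables (T : finType) (x : nat).
Implicit Types (P Q : {set {set T}}) (f g : {ffun {set T} -> 'I_x.+1}).
Local Open Scope nat_scope.

(** Labels range over ]a, x]: the bound [a = 0] gives all labelings, and a
    positive bound the labels that a core leaves to the other blocks. Functions
    on all subsets, null outside P, as in [block_labelings]. *)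
Definition labelings (a : nat) P : {set {ffun {set T} -> 'I_x.+1}} :=
  [set f in pffun_on ord0 (mem P) [pred k : 'I_x.+1 | a < k]].

Lemma labelingsP a P f : reflect
  (forall B, if B \in P then a < f B else f B == ord0) (f \in labelings a P).
Proof.
rewrite inE; apply: (iffP familyP) => fP B; have := fP B; by case: ifP.
Qed.

Lemma card_labelings a P : #|labelings a P| = (x - a) ^ #|P|.
Proof.
rewrite cardsE card_pffun_on; congr (_ ^ _).
have [le_xa|/ltnW le_ax] := leqP x a.
  rewrite (eqP le_xa) eq_card0 // => k; rewrite !inE ltnNge.
  by rewrite (leq_trans _ le_xa) // -ltnS.
rewrite -[LHS]cardsE -(card_ord (x - a)).
have lt_x (k : 'I_(x - a)) : a + k.+1 < x.+1 by rewrite addnS ltnS -ltn_subRL.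
rewrite -[RHS](card_imset (f := fun k => Ordinal (lt_x k))); last first.
  by move=> i j [] /addnI [] /val_inj.
apply: eq_card => k; rewrite inE.
apply/idP/imsetP => [lt_ak|[j _ ->]]; last first.
  by rewrite inE /= -addSnnS leq_addr.
have lt_k : k - a.+1 < x - a.
  by rewrite -[x - a]subSS ltn_sub2r // ltnS (leq_trans lt_ak) // -ltnS.
by exists (Ordinal lt_k) => //; apply: val_inj; rewrite /= -addSnnS subnKC.
Qed.

Definition low P f v : {set {set T}} := [set B in P | f B <= v].

(** With the sorted entries numbered from 0, the entry of rank i is at most z_i
    exactly when more than i points carry a label at most z_i. This form makes sense for any set P of
    blocks and involves no sorting. *)
Definition parking_on P f : bool :=
  [forall i : 'I_#|cover P|, i < #|cover (low P f (z i))|].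

Definition parking_labelings P := [set f in labelings 0 P | parking_on P f].

Definition is_core P f Q : bool :=
  parking_on Q f && [forall B in P :\: Q, z #|cover Q| < f B].

Lemma cover_mono P Q : P \subset Q -> #|cover P| <= #|cover Q|.
Proof.
move=> sPQ; apply/subset_leq_card/bigcupsP => B PB.
exact/bigcup_sup/(subsetP sPQ).
Qed.

(** Let m be the least i such that at most i points carry a label at most z_i.
    The blocks with label at most z_m have m points in all, by minimality of m,
    and form a core. Conversely a core Q with q points consists of the blocks
    with label at most z_q, since its parking condition at q - 1 accounts for
    all its points; hence m <= q, and m < q would contradict the parking
    condition at m. *)
Lemma parking_core P f : trivIset P -> set0 \notin P ->
  exists Q0, forall Q, (Q \subset P) && is_core P f Q = (Q == Q0).
Proof.
move=> tiP P0.
have sLP v : low P f v \subset P by apply/subsetP => B; rewrite inE => /andP[].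
have exi : exists i, #|cover (low P f (z i))| <= i.
  by exists #|cover P|; apply: cover_mono.
case: (ex_minnP exi) => m le_m min_m.
have minN i : i < m -> i < #|cover (low P f (z i))|.
  by apply: contraTT; rewrite -!leqNgt; apply: min_m.
exists (low P f (z m)) => Q; apply/idP/eqP => [|->]; last first.
  (* At most m points by the choice of m, at least m because m - 1 fails. *)
  have cm : #|cover (low P f (z m))| = m.
    apply/eqP; rewrite eqn_leq le_m; case: (m) minN => // k minN.
    apply: leq_trans (minN k _) _ => //; apply: cover_mono.
    apply/subsetP => B; rewrite !inE => /andP[->] /= /leq_trans-> //.
    exact: z_mono.
  rewrite sLP /=; apply/andP; split; last first.
    rewrite cm; apply/forall_inP => B /setDP[PB].
    by rewrite inE PB /= -ltnNge.
  rewrite /parking_on cm; apply/forallP => i.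
  apply: leq_trans (minN i _) _ => //.
  apply: cover_mono; apply/subsetP => B; rewrite !inE => /andP[-> le_B] /=.
  by rewrite le_B (leq_trans le_B) // z_mono // ltnW.
case/and3P=> sQP /forallP parkQ /forall_inP outQ.
have lowQ : low P f (z #|cover Q|) = Q.
  apply/setP=> B; rewrite inE; apply/andP/idP => [[PB]|QB].
    by apply: contraTT => nQB; rewrite -ltnNge outQ // inE nQB.
  have PB := subsetP sQP _ QB; split=> //.
  have /set0Pn[i Bi] : B != set0 by apply: contraNneq P0 => <-.
  have cQi : i \in cover Q by apply/bigcupP; exists B.
  case def_q : #|cover Q| => [|q].
    by move/eqP: def_q; rewrite cards_eq0 => /eqP cQ0; rewrite cQ0 inE in cQi.
  have lt_q : q < #|cover Q| by rewrite def_q.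
  have := parkQ (Ordinal lt_q); rewrite /= -def_q => le_q.
  have sL : cover (low Q f (z q)) \subset cover Q.
    by apply/bigcupsP => C; rewrite inE => /andP[QC _]; apply: bigcup_sup.
  have /eqP eqL : cover (low Q f (z q)) == cover Q.
    by rewrite eqEcard sL le_q.
  have /bigcupP[C] : i \in cover (low Q f (z q)) by rewrite eqL.
  rewrite inE => /andP[QC le_C] Ci.
  rewrite -(def_pblock tiP PB Bi) (def_pblock tiP (subsetP sQP _ QC) Ci).
  by rewrite (leq_trans le_C) // z_mono // def_q.
(* Q is the set of blocks with label at most z_q; it remains to show q = m. *)
suff <- : #|cover Q| = m by [].
apply/eqP; rewrite eqn_leq min_m ?lowQ // andbT leqNgt; apply/negP => lt_m.
have := parkQ (Ordinal lt_m); rewrite ltnNge => /negP[] /=.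
apply: leq_trans le_m; apply: cover_mono; apply/subsetP => B.
by rewrite !inE => /andP[/(subsetP sQP)-> ->].
Qed.

Lemma parking_on_eq Q f g : {in Q, f =1 g} -> parking_on Q f = parking_on Q g.
Proof.
move=> eqfg; apply: eq_forallb => i; congr (_ < #|cover _|).
by apply/setP=> B; rewrite !inE; case: (boolP (B \in Q)) => //= /eqfg ->.
Qed.

(** On Q any parking labeling is allowed, and independently any labels above the
    threshold on the other blocks. *)
Lemma card_core P Q : Q \subset P ->
  #|[set f in labelings 0 P | is_core P f Q]| =
  #|parking_labelings Q| * (x - z #|cover Q|) ^ #|P :\: Q|.
Proof.
move=> sQP; rewrite -card_labelings -cardsX.
pose merge (fg : {ffun {set T} -> 'I_x.+1} * {ffun {set T} -> 'I_x.+1}) :=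
  [ffun B => if B \in Q then fg.1 B else fg.2 B].
rewrite -(card_in_imset (f := merge)) => [|[f1 g1] [f2 g2]]; last first.
  case/setXP=> /setIdP[/labelingsP /= f1P _] /labelingsP g1P.
  case/setXP=> /setIdP[/labelingsP /= f2P _] /labelingsP g2P.
  move/ffunP=> eq_merge; congr pair; apply/ffunP=> B.
    have:= eq_merge B; rewrite !ffunE /=; have:= f1P B; have:= f2P B.
    by case: ifP => // _ /eqP-> /eqP->.
  have:= eq_merge B; rewrite !ffunE /=; have:= g1P B; have:= g2P B.
  by rewrite inE; case: (B \in Q) => //= /eqP-> /eqP->.
apply: eq_card => h; rewrite inE; apply/andP/imsetP=> [|[[f g]]].
  case=> /labelingsP hP /andP[parkQ /forall_inP out].
  pose f := [ffun B => if B \in Q then h B else ord0].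
  pose g := [ffun B => if B \in P :\: Q then h B else ord0].
  have fE : {in Q, f =1 h} by move=> B QB; rewrite ffunE QB.
  exists (f, g); last first.
    apply/ffunP=> B; rewrite !ffunE inE; case: (boolP (B \in Q)) => //= _.
    by have:= hP B; case: ifP => // _ /eqP.
  apply/setXP; split=> /=.
    rewrite inE (parking_on_eq fE) parkQ andbT; apply/labelingsP => B.
    rewrite ffunE; case: (boolP (B \in Q)) => // QB.
    by have:= hP B; rewrite (subsetP sQP _ QB).
  apply/labelingsP=> B; rewrite ffunE.
  by case: (boolP (B \in P :\: Q)) => // /out.
case/setXP=> /setIdP[/labelingsP /= fP parkQ] /labelingsP gP ->.
have mE : {in Q, merge (f, g) =1 f} by move=> B QB; rewrite ffunE QB.
split; last first.
  rewrite /is_core (parking_on_eq mE) parkQ; apply/forall_inP => B PQB.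
  have:= gP B; rewrite PQB ffunE; by case/setDP: PQB => _ /negbTE->.
apply/labelingsP => B; rewrite ffunE /=; have:= fP B; have:= gP B.
rewrite inE; have [QB|nQB] /= := boolP (B \in Q).
  by rewrite (subsetP sQP).
by case: ifP => // _ lt_g _; apply: leq_trans lt_g.
Qed.

Lemma labelings_split P : trivIset P -> set0 \notin P ->
  x ^ #|P| = \sum_(Q : {set {set T}} | Q \subset P)
    #|parking_labelings Q| * (x - z #|cover Q|) ^ #|P :\: Q|.
Proof.
move=> tiP P0; rewrite -{1}(subn0 x) -card_labelings -sum1_card.
transitivity (\sum_(f in labelings 0 P)
   \sum_(Q : {set {set T}} | (Q \subset P) && is_core P f Q) 1).
  apply: eq_bigr => f _; have [Q0 Q0P] := parking_core f tiP P0.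
  by rewrite (big_pred1 Q0).
rewrite (exchange_big_dep (fun Q : {set {set T}} => Q \subset P)) /=;
  last by move=> f Q _ /andP[].
apply: eq_bigr => Q sQP; rewrite -card_core // -sum1dep_card.
by apply: eq_bigl => f; rewrite sQP.
Qed.
End Parking.

(** * Comparison with parking functions on sorted sequences *)

Lemma nth_sort_leq (s : seq nat) i v : (i < size s)%N ->
  (nth 0 (sort leq s) i <= v)%N = (i < count (fun k => k <= v) s)%N.
Proof.
move=> lt_is; have srt : sorted leq (sort leq s) by apply/sort_sorted/leq_total.
rewrite -(count_sort leq); apply/idP/idP; last first.
  exact: (@nth_count_le _ nat v 0 _ i srt).
apply: contraTT; rewrite -leqNgt -ltnNge => le_i.
apply: (@nth_count_gt _ nat v 0 _ i srt).
by rewrite le_i size_sort.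
Qed.

Lemma card_cover_low n (P : {set {set 'I_n}}) x
    (f : {ffun {set 'I_n} -> 'I_x.+1}) v :
  partition P [set: 'I_n] ->
  #|cover (low P f v)| = count (fun k => k <= v)%N (label_seq P f).
Proof.
move=> partP; rewrite /label_seq count_map enumT cardE /enum_mem size_filter.
apply: eq_count => i /=; have cPi : i \in cover P.
  by rewrite (cover_partition partP) inE.
apply/bigcupP/idP => [[B]|le_f].
  rewrite inE => /andP[PB le_B] Bi.
  by rewrite (def_pblock (partition_trivIset partP) PB Bi).
by exists (pblock P i); rewrite ?mem_pblock // inE pblock_mem.
Qed.

Lemma PF_parking_labelings n (z : nat -> nat) x (P : {set {set 'I_n}}) :
  partition P [set: 'I_n] -> PF z x P = #|parking_labelings z x P|.
Proof.
move=> partP; apply: eq_card => f; rewrite [LHS]inE [RHS]inE.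
have -> : (f \in block_labelings x P) = (f \in labelings x 0 P) by rewrite !inE.
case: (boolP (f \in labelings x 0 P)) => //= /labelingsP fP.
have sz : size (label_seq P f) = n by rewrite size_map size_enum_ord.
rewrite /parking /parking_on (_ : all _ _ = true) /=; last first.
  apply/allP => _ /mapP[i _ ->]; have:= fP (pblock P i).
  by rewrite pblock_mem // (cover_partition partP) inE.
have -> : #|cover P| = size (label_seq P f).
  by rewrite (cover_partition partP) cardsT card_ord sz.
by apply: eq_forallb => i; rewrite nth_sort_leq // card_cover_low.
Qed.

(** * Weighted parking sums are values of Goncarov polynomials *)

(** Multiplying [labelings_split] by the weight of P and summing over the
    partitions of D yields, through [sum_partition_split], the recurrence for
    the parking sums over the subsets of D. *)
Lemma goncarov_parking (R : comNzRingType) (w : nat -> R) (z : nat -> nat)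
    (n x : nat) y t :
  {homo z : i j / (i <= j)%N} -> (forall i, (i < n)%N -> (z i <= x)%N) ->
  goncarov_seq w y t -> (forall i, y i = x%:R - (z i)%:R) ->
  (t n).[x%:R] = \sum_(P : {set {set 'I_n}} | partition P [set: 'I_n])
    block_weight w P * (#|parking_labelings z x P|)%:R.
Proof.
move=> z_mono le_zx tP yE.
pose F (D : {set 'I_n}) := \sum_(P | partition P D)
  block_weight w P * (#|parking_labelings z x P|)%:R.
suff /(_ setT): forall D, F D = (t #|D|).[x%:R] by rewrite cardsT card_ord.
apply: (goncarov_set_uniq tP) => D; rewrite block_poly_set.
transitivity (\sum_(P | partition P D) \sum_(Q : {set {set 'I_n}} | Q \subset P)
  (block_weight w Q * (#|parking_labelings z x Q|)%:R) *
  (block_weight w (P :\: Q) * ((x - z #|cover Q|) ^ #|P :\: Q|)%:R)).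
  apply: eq_bigr => P /and3P[_ tiP P0].
  rewrite -natrX (labelings_split z_mono x tiP P0) natr_sum mulr_sumr.
  by apply: eq_bigr => Q sQP; rewrite (block_weightD _ sQP) natrM mulrACA.
rewrite (sum_partition_split D (fun Q P =>
  (block_weight w Q * (#|parking_labelings z x Q|)%:R) *
  (block_weight w P * ((x - z #|cover Q|) ^ #|P|)%:R))).
apply: eq_bigr => S sSD; rewrite mulrC mulr_suml; apply: eq_bigr => Q partQ.
rewrite (cover_partition partQ) block_poly_set mulr_sumr.
apply: eq_bigr => P partP; congr (_ * (_ * _)).
(* When S is the whole set there is no block left and both powers are 1; this
   is the only case in which x - z_#|S| may be truncated. *)
have := max_card [in S]; rewrite card_ord leq_eqVlt => /orP[/eqP cardS|lt_S].
  have S_T : S = setT.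
    by apply/eqP; rewrite eqEcard subsetT cardsT card_ord cardS /=.
  move: partP; rewrite S_T setDT partition_set0 => /eqP ->.
  by rewrite cards0 expn0 expr0.
by rewrite yE natrX natrB ?le_zx.
Qed.

(** * Specialisation to the polynomial ring in the block weights *)

Section Specialisation.
Variable K : fieldType.
Local Notation A := {malg K[{cmonom nat}]}.

(** The product over block sizes, regrouped as a product over blocks; the size 0
    contributes nothing since [wvar K 0] is 1. *)
Lemma weightE n (P : {set {set 'I_n}}) :
  weight K P = block_weight (wvar K : nat -> A) P.
Proof.
rewrite /block_weight.
have sz (B : {set 'I_n}) : (#|B| < n.+1)%N.
  by rewrite ltnS (leq_trans (max_card _)) ?card_ord.
rewrite (partition_big (fun B : {set 'I_n} => inord #|B| : 'I_n.+1) xpredT) //=.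
transitivity (\prod_(i < n.+1) wvar K i ^+ #|[set B in P | #|B| == i]|).
  rewrite -(big_mkord xpredT
    (fun i => wvar K i ^+ #|[set B in P | #|B| == i]|)).
  rewrite [RHS]big_ltn //.
  by rewrite [X in X * _](_ : _ = 1) ?mul1r // /wvar leq0n expr1n.
apply: eq_bigr => i _; rewrite -prodr_const.
apply: eq_big => [B | B]; rewrite inE; last by case/andP=> _ /eqP ->.
by rewrite -(inj_eq val_inj) /= inordK.
Qed.

Lemma gon_basisE n : gon_basis K n = block_poly (wvar K : nat -> A) n.
Proof. by apply: eq_bigr => P _; rewrite weightE. Qed.

Lemma goncarov_seqP (Y : nat -> K) :
  goncarov_seq (wvar K : nat -> A) (fun i => (Y i)%:A) (goncarov Y).
Proof.
move=> n; rewrite -gon_basisE (goncarovP Y n).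
by apply: eq_bigr => i _; rewrite gon_basisE.
Qed.

End Specialisation.

Theorem theorem3 (K : fieldType) (charK0 : [pchar K] =i pred0)
    (z : nat -> nat) (z_gt0 : forall i : nat, (0 < z i)%N)
    (z_mono : forall i j : nat, (i <= j)%N -> (z i <= z j)%N)
    (n : nat) (n_gt0 : (1 <= n)%N) (x : nat) (x_gt : (z n.-1 < x)%N) :
  (goncarov (fun i => - (z i)%:R : K) n).[0]
    = (goncarov (fun i => x%:R - (z i)%:R : K) n).[x%:R]
  /\
  (goncarov (fun i => x%:R - (z i)%:R : K) n).[x%:R]
    = \sum_(P : {set {set 'I_n}} | partition P [set: 'I_n])
        weight K P * (PF z x P)%:R.
Proof.
have scale_nat k : (k%:R : K)%:A = k%:R :> {malg K[{cmonom nat}]}.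
  by rewrite scaler_nat.
split.
  have shiftY i : (x%:R - (z i)%:R : K)%:A =
      x%:R + (- (z i)%:R : K)%:A :> {malg K[{cmonom nat}]}.
    by rewrite scalerDl scale_nat.
  exact: (goncarov_shift0 n (goncarov_seqP _) (goncarov_seqP _) shiftY).
have le_zx i : (i < n)%N -> (z i <= x)%N.
  move=> lt_in; rewrite ltnW // (leq_ltn_trans _ x_gt) // z_mono //.
  by rewrite -ltnS prednK.
rewrite (goncarov_parking z_mono le_zx (goncarov_seqP _)) => [|i].
  by apply: eq_bigr => P partP; rewrite weightE PF_parking_labelings.
by rewrite scalerBl !scale_nat.
Qed.
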